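(* Let $G$ be a graph. Then there exists a sign $\sigma$ for $G$ such that the signed adjacency matrix $A(G^{\sigma})$ has full rank (i.e. rank equal to $|V(G)|$) if and only if $G$ has full perrank, i.e. if and only if $G$ has a $\{1,2\}$-factor.
   Context: All graphs are simple, undirected and finite. A $\{1,2\}$-factor of a graph $G$ is a spanning subgraph of $G$ that is a vertex-disjoint union of copies of $K_2$ and cycles. The perrank of a graph $G$ of order $n$ is the order of its largest subgraph which is a vertex-disjoint union of copies of $K_2$ and cycles; $G$ has full perrank if its perrank equals $n$. A sign of $G$ is a map $\sigma: E(G)\to\{-1,1\}$; the signed graph is $G^{\sigma}$. For $V(G)=\{v_1,\dots,v_n\}$, the signed adjacency matrix $A(G^{\sigma})=[a_{ij}]$ is the $n\times n$ matrix with $a_{ij}=\sigma(v_iv_j)$ if $v_i$ and $v_j$ are adjacent and $a_{ij}=0$ otherwise. The rank of $G^{\sigma}$ is the rank of $A(G^{\sigma})$. *)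

(* Defs.v *)
From HB Require Import structures.
From mathcomp Require Import all_boot all_order all_algebra.

Set Implicit Arguments.
Unset Strict Implicit.
Unset Printing Implicit Defensive.

Import GRing.Theory Num.Theory.
Local Open Scope ring_scope.

Record sgraph := SGraph {
  vertex :> finType;
  adj : rel vertex;
  adj_sym : symmetric adj;
  adj_irrefl : irreflexive adj
}.

Definition edges (G : sgraph) : {set {set G}} :=
  [set E : {set G} | [exists x, exists y, adj x y && (E == [set x; y])]].

Section Subgraphs.
Variable T : finType.

(* A pair (V, E): vertex set V and edge set E, all inside the ambient type T. *)
Definition pregraph : finType := ({set T} * {set {set T}})%type.

Implicit Types H C : pregraph.

Definition verts H : {set T} := H.1.
Definition pedges H : {set {set T}} := H.2.

Definition is_K2 C : bool :=
  [exists x, exists y, [&& x != y, verts C == [set x; y]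
                         & pedges C == [set [set x; y]]]].

(* s lists the vertices in cyclic order; [next s x] is the successor of x. *)
Definition is_cycle C : bool :=
  [exists s : #|verts C|.-tuple T,
     [&& (3 <= size s)%N, uniq s, verts C == [set x in s]
       & pedges C == [set [set x; next s x] | x in s]]].

Definition K2_cycle_union H : bool :=
  [exists P : {set pregraph},
     [&& [forall C in P, is_K2 C || is_cycle C],
         [forall C in P, forall D in P,
            (C != D) ==> [disjoint verts C & verts D]],
         verts H == \bigcup_(C in P) verts C
       & pedges H == \bigcup_(C in P) pedges C]].

End Subgraphs.

Definition is_subgraph (G : sgraph) (H : pregraph G) : bool :=
  (pedges H \subset edges G) && [forall E in pedges H, E \subset verts H].

Definition has_12_factor (G : sgraph) : Prop :=
  exists H : pregraph G,
    [/\ is_subgraph H, verts H = [set: G] & K2_cycle_union H].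

Definition perrank (G : sgraph) : nat :=
  \max_(H : pregraph G | is_subgraph H && K2_cycle_union H) #|verts H|.

Definition full_perrank (G : sgraph) : Prop := perrank G = #|G|.

(* Only the values on edges matter; those outside [edges G] are junk. *)
Definition is_sign (G : sgraph) (sigma : {set G} -> int) : Prop :=
  forall E, E \in edges G -> sigma E = -1 \/ sigma E = 1.

Definition signed_adjacency (R : realFieldType) (G : sgraph)
    (sigma : {set G} -> int) : 'M[R]_#|G| :=
  \matrix_(i, j) (if adj (enum_val i) (enum_val j)
                  then (sigma [set enum_val i; enum_val j])%:~R else 0).

(* Main.v *)
Require Import Defs.
From mathcomp Require Import all_boot all_order all_algebra all_fingroup.

(** Both directions go through permutations: a {1,2}-factor amounts to a
    permutation [s] of the vertices with [x] adjacent to [s x] for all [x]. A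
    nonzero term of the Leibniz expansion is such an [s]. Conversely, given [s],
    the determinant is a polynomial in the signs, and we take its Fourier
    coefficient at the set of edges traversed an odd number of times by [s],
    that is, the edges of the long cycles of [s]. The permutations contributing
    to it have the same long-cycle edges as [s], so they have the same long
    cycles up to orientation, and the other points lie in 2-cycles. Hence they
    all have the signature of [s]: no cancellation occurs, the coefficient is
    nonzero, and so is the determinant for some sign. *)

Set Implicit Arguments.
Unset Strict Implicit.
Unset Printing Implicit Defensive.

Import Order.TTheory GRing.Theory Num.Theory.
Local Open Scope ring_scope.

(** * How edge parities of a fixed-point-free permutation determine its signature *)

Section Traversals.
Variable T : finType.
Implicit Types (s t : {perm T}) (a b x : T) (E : {set T}).

(** On pairs of distinct points, a 2-cycle traverses its edge twice and a longer cycle traverses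
    each of its edges once, so oddness singles out the edges of long cycles. *)
Definition traversals s E : nat := #|[set x | [set x; s x] == E]|.

Lemma eq_set2l a b x : a != b -> ([set a; x] == [set a; b]) = (x == b).
Proof.
move=> ab; apply/eqP/eqP => [/setP/(_ b)|->//].
by rewrite !inE eqxx orbT eq_sym (negbTE ab) eq_sym => /eqP.
Qed.

Lemma traversals2 s a b :
  a != b -> traversals s [set a; b] = ((s a == b) + (s b == a))%N.
Proof.
move=> ab; have ba : b != a by rewrite eq_sym.
rewrite /traversals -sum1dep_card big_mkcond (bigD1 a) // (bigD1 b) //=.
rewrite eq_set2l // [X in [set _; _] == X]setUC eq_set2l //.
rewrite big1 ?addn0; first by do 2!case: (_ == _).
move=> x /andP[xa xb]; case: eqP => // /setP/(_ x).
by rewrite !inE eqxx (negbTE xa) (negbTE xb).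
Qed.

Section SameParity.
Variables s t : {perm T}.
Hypothesis st : forall E, odd (traversals s E) = odd (traversals t E).

Lemma parity_arc a b :
  (s a == b) (+) (s b == a) = (t a == b) (+) (t b == a).
Proof.
have [->|ab] := eqVneq a b; first by rewrite !addbb.
by have := st [set a; b]; rewrite !traversals2 // !oddD !oddb.
Qed.

(** If [t] had [a] in an orbit of size at most 2, then [t a = s a] and [t (s a) = a] would be
    equivalent, so [t] would traverse [{a, s a}] an even number of times, whereas [s] does so
    once. *)
Lemma parity_long a : s (s a) != a -> t (t a) != a.
Proof.
move=> sa; apply/eqP => ta; have := parity_arc a (s a).
rewrite eqxx (negbTE sa) /=; case: eqP => [<-|ne]; first by rewrite ta eqxx.
by case: eqP => // ts; case: ne; apply: (@perm_inj _ t); rewrite ts ta.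
Qed.

Lemma parity_step a : t (t a) != a -> t a \in porbit s a.
Proof.
move=> ta; have := parity_arc a (t a); rewrite eqxx (negbTE ta) /=.
case: eqP => [<- _|_ /=]; first exact: (mem_porbit s 1).
case: eqP => // sta _; rewrite porbit_sym -{1}sta.
exact: (mem_porbit s 1).
Qed.

Lemma parity_porbit_sub a : t (t a) != a -> porbit t a \subset porbit s a.
Proof.
move=> ta; apply/subsetP => _ /porbitP[n ->].
elim: n => [|n IHn]; first by rewrite expg0 perm1 porbit_id.
rewrite expgSr permM; move: IHn; rewrite -!eq_porbit_mem => /eqP <-.
rewrite eq_porbit_mem; apply: parity_step.
(* Powers of [t] commute, so every point of the orbit inherits the hypothesis on [a] and the step
   applies again. *)
have -> : t (t ((t ^+ n)%g a)) = (t ^+ n)%g (t (t a)).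
  by elim: n => [|n IHn]; rewrite ?perm1 // expgSr !permM IHn.
by rewrite (inj_eq perm_inj).
Qed.

End SameParity.

Lemma card_porbit_involutive s a : s a != a -> s (s a) = a -> #|porbit s a| = 2.
Proof.
move=> sa ssa; suff -> : porbit s a = [set a; s a] by rewrite cards2 eq_sym sa.
apply/eqP; rewrite eqEsubset subUset !sub1set porbit_id (mem_porbit s 1) !andbT.
apply/subsetP => _ /porbitP[n ->]; elim: n => [|n]; first by rewrite perm1 set21.
by rewrite expgSr permM !inE => /orP[]/eqP ->; rewrite ?ssa eqxx ?orbT.
Qed.

(** Each orbit contributes 1 in total. Orbit counts can thus be compared point by point, with no
    bijection between orbits. *)
Lemma card_porbits s :
  #|porbits s|%:R = \sum_x (#|porbit s x|%:R)^-1 :> rat.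
Proof.
rewrite (partition_big_imset (porbit s)) -sumr_const.
apply: eq_bigr => _ /imsetP[x _ ->].
have card_neq0 : #|porbit s x|%:R != 0 :> rat.
  by rewrite pnatr_eq0 -lt0n; apply/card_gt0P; exists x; apply: porbit_id.
rewrite (eq_bigr (fun=> (#|porbit s x|%:R)^-1)) => [|y /eqP -> //].
rewrite (eq_bigl (mem (porbit s x))) => [|y]; last by rewrite /= eq_porbit_mem.
by rewrite sumr_const -[_ *+ _]mulr_natr mulVf.
Qed.

Lemma odd_perm_traversals s t :
    (forall x, s x != x) -> (forall x, t x != x) ->
    (forall E, odd (traversals s E) = odd (traversals t E)) ->
  s = t :> bool.
Proof.
move=> sN tN st; have ts E : odd (traversals t E) = odd (traversals s E) by [].
(* The signature is the parity of the number of points plus the number of orbits. *)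
rewrite /odd_perm; congr (_ (+) odd _); apply/eqP.
rewrite -(eqr_nat rat) !card_porbits; apply/eqP/eq_bigr => x _.
(* Points of 2-cycles of [s] lie in 2-cycles of [t], perhaps different ones; elsewhere the two
   orbits coincide. *)
congr (_%:R^-1); have [sx|sx] := eqVneq (s (s x)) x.
  rewrite !card_porbit_involutive //; apply/eqP/negPn/negP.
  by move/(parity_long ts); rewrite sx eqxx.
apply: eq_card; apply/setP/eqP; rewrite eqEsubset.
by rewrite !parity_porbit_sub ?(parity_long st).
Qed.

End Traversals.

Lemma sum_sign_ge0 (R : realFieldType) m : 0 <= \sum_(b : bool) ((-1 : R) ^+ b) ^+ m.
Proof.
by rewrite big_bool /= expr1 expr0 expr1n -signr_odd; case: odd;
  rewrite ?expr1 ?addNr ?expr0 ?addr_ge0.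
Qed.

(** * Nonvanishing of the determinant for some sign *)

Section SignedDeterminant.
Variables (R : realFieldType) (n : nat) (e : rel 'I_n).
Hypothesis e_irr : irreflexive e.
Local Notation signs := {ffun {set 'I_n} -> bool}.
Implicit Types (s t : 'S_n) (f : signs).

(** Every set gets a sign, edge or not, so that a sum over [f] splits into independent choices; a
    set that is never traversed only contributes a factor 2. *)
Definition sign_mx f : 'M[R]_n :=
  \matrix_(i, j) (if e i j then (-1) ^+ f [set i; j] else 0).

(* Up to the number of sign functions, this is the Fourier coefficient at the
   edges of odd multiplicity in [s] of the Leibniz monomial of [t]. *)
Definition fourier_weight s t : R :=
  \prod_(E : {set 'I_n})
     \sum_(b : bool) ((-1) ^+ b) ^+ (traversals s E + traversals t E).

Lemma prod_sign_mx f t : (forall i, e i (t i)) ->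
  \prod_i sign_mx f i (t i) = \prod_E ((-1) ^+ f E) ^+ traversals t E.
Proof.
move=> et; rewrite (partition_big (fun i => [set i; t i]) xpredT) //=.
apply: eq_bigr => E _; rewrite /traversals -[RHS]prodr_const.
by apply: eq_big => i; rewrite ?inE // mxE et => /eqP ->.
Qed.

Lemma sum_fourier s t : (forall i, e i (t i)) ->
  \sum_(f : signs) (\prod_E ((-1) ^+ f E) ^+ traversals s E) * \prod_i sign_mx f i (t i)
    = fourier_weight s t.
Proof.
move=> et; rewrite /fourier_weight bigA_distr_bigA /=.
apply: eq_bigr => f _; rewrite prod_sign_mx // -big_split /=.
by apply: eq_bigr => E _; rewrite exprD.
Qed.

Lemma fourier_weight_ge0 s t : 0 <= fourier_weight s t.
Proof. by apply: prodr_ge0 => E _; apply: sum_sign_ge0. Qed.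

Lemma fourier_weight_gt0 s : 0 < fourier_weight s s.
Proof.
apply: prodr_gt0 => E _; rewrite big_bool /= expr0 expr1n expr1 -signr_odd.
by rewrite addnn odd_double expr0 addr_gt0.
Qed.

Lemma fourier_weight_neq0 s t : fourier_weight s t != 0 ->
  forall E, odd (traversals s E) = odd (traversals t E).
Proof.
move=> /prodf_neq0 w E; have := w E isT.
rewrite big_bool /= expr0 expr1n expr1 -signr_odd oddD.
by case: (odd _) (odd _) => [] [] //=; rewrite expr1 addNr eqxx.
Qed.

Lemma exists_sign_det_neq0 s : (forall i, e i (s i)) ->
  exists f, \det (sign_mx f) != 0.
Proof.
move=> es; apply/existsP/contraT => /existsPn det0.
have eN t : (forall i, e i (t i)) -> forall i, t i != i.
  by move=> et i; apply: contraTneq (et i) => ->; rewrite e_irr.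
pose c f : R := \prod_E ((-1) ^+ f E) ^+ traversals s E.
(* If all determinants vanish, so does this Fourier coefficient; the factor [(-1) ^+ s] makes its
   terms nonnegative. *)
have : (-1) ^+ s * \sum_(f : signs) c f * \det (sign_mx f) = 0.
  rewrite big1 ?mulr0 // => f _.
  by have /negPn/eqP -> := det0 f; rewrite mulr0.
have -> : (-1) ^+ s * \sum_(f : signs) c f * \det (sign_mx f) =
    \sum_(t : 'S_n) (if [forall i, e i (t i)]
            then (-1) ^+ s * (-1) ^+ t * fourier_weight s t else 0).
  rewrite /determinant; under eq_bigr do rewrite mulr_sumr.
  rewrite exchange_big mulr_sumr /=; apply: eq_bigr => t _.
  case: ifPn => [/forallP et|/forallPn[i /negbTE eti]].
    rewrite -mulrA -(sum_fourier s et) (mulr_sumr _ _ _ ((-1) ^+ t)).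
    by congr (_ * _); apply: eq_bigr => f _; rewrite mulrCA.
  rewrite big1 ?mulr0 // => f _.
  by rewrite (bigD1 i) //= mxE eti mul0r !mulr0.
(* A vanishing sum of nonnegative terms has only zero terms, but the term [t = s] is positive. *)
move/eqP; rewrite psumr_eq0 => [/allP/(_ s (mem_index_enum _))|t _].
  rewrite ifT; last exact/forallP.
  by rewrite -expr2 sqrr_sign mul1r (gt_eqF (fourier_weight_gt0 s)).
case: ifP => // /forallP et; have [->|/fourier_weight_neq0 st] :=
  eqVneq (fourier_weight s t) 0; first by rewrite mulr0.
rewrite (odd_perm_traversals (eN _ es) (eN _ et) st) -expr2 sqrr_sign mul1r.
exact: fourier_weight_ge0.
Qed.

End SignedDeterminant.

(** * Factors as permutations along edges, perrank, and the adjacency matrix *)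

Section Factors.
Variable G : sgraph.

Lemma mem_edges2 (x y : G) : ([set x; y] \in edges G) = adj x y.
Proof.
rewrite inE; apply/existsP/idP => [[a /existsP[b /andP[ab /eqP E]]]|xy].
  have xNy : x != y.
    apply: contraTneq ab => xy; move: E; rewrite xy setUid => /setP E.
    have := E a; have := E b; rewrite !inE !eqxx orbT => /eqP -> /eqP ->.
    by rewrite adj_irrefl.
  have : x \in [set a; b] by rewrite -E set21.
  have : y \in [set a; b] by rewrite -E set22.
  rewrite !inE => /orP[]/eqP y_ /orP[]/eqP x_; subst x y; rewrite ?eqxx // in xNy *.
  by rewrite adj_sym.
by exists x; apply/existsP; exists y; rewrite xy eqxx.
Qed.

(** Swap the ends of a K2; follow [next] around a cycle, which fixes all points off the list. *)
Lemma component_perm (C : pregraph G) : is_K2 C || is_cycle C ->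
  exists g : {perm G}, forall x, x \in verts C ->
    (g x \in verts C) && ([set x; g x] \in pedges C).
Proof.
case/orP => [/existsP[a /existsP[b /and3P[ab /eqP VC /eqP EC]]]|].
  exists (tperm a b) => x; rewrite VC EC !inE => /orP[]/eqP ->.
    by rewrite tpermL !eqxx orbT.
  by rewrite tpermR setUC !eqxx.
case/existsP => -[c c_size] /and4P[_ /= Uc /eqP VC /eqP EC].
have {}VC : verts C = [set x in c] := VC.
have {}EC : pedges C = [set [set x; next c x] | x in c] := EC.
exists (perm (can_inj (prev_next Uc))) => x; rewrite EC VC !inE permE => xc.
by rewrite mem_next xc; apply/imsetP; exists x.
Qed.

Lemma factor_perm :
  has_12_factor G -> exists s : {perm G}, forall x, adj x (s x).
Proof.
case=> H [/andP[/subsetP sHG _] VH /existsP[P /and4P[/forall_inP PC]]].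
move=> /forall_inP Pdis /eqP VP /eqP EP.
have /fin_all_exists[g gP] (C : pregraph G) : exists g : {perm G},
    C \in P -> forall x, x \in verts C ->
      (g x \in verts C) && ([set x; g x] \in pedges C).
  case CP: (C \in P); last by exists 1%g.
  by have [g gC] := component_perm (PC C CP); exists g.
have /fin_all_exists[comp compP] (x : G) : exists C, (C \in P) && (x \in verts C).
  have : x \in verts H by rewrite VH inE.
  by rewrite VP => /bigcupP[C CP xC]; exists C; rewrite CP.
have comp_uniq x C : C \in P -> x \in verts C -> comp x = C.
  move=> CP xC; have /andP[DP xD] := compP x; apply/eqP/negPn/negP => DC.
  have /forall_inP/(_ _ CP)/implyP/(_ DC)/pred0P/(_ x) := Pdis _ DP.
  by rewrite /= xD xC.
(* Each vertex moves by the permutation of its own component. As [h] preserves components,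
   injectivity reduces to that of each [g C]. *)
pose h x := g (comp x) x.
have hP x : (h x \in verts (comp x)) && ([set x; h x] \in pedges (comp x)).
  by have /andP[CP xC] := compP x; apply: gP.
have comp_h x : comp (h x) = comp x.
  by have /andP[CP _] := compP x; have /andP[hC _] := hP x; apply: comp_uniq.
have h_inj : injective h.
  move=> x y hxy; have cxy : comp x = comp y by rewrite -comp_h hxy comp_h.
  by move: hxy; rewrite /h cxy => /perm_inj.
exists (perm h_inj) => x; rewrite permE -mem_edges2; apply: sHG.
rewrite EP; apply/bigcupP; exists (comp x); first by case/andP: (compP x).
by case/andP: (hP x).
Qed.

Definition porbit_graph (s : {perm G}) x : pregraph G :=
  (porbit s x, [set [set y; s y] | y in porbit s x]).

Lemma porbit_graph_K2_cycle (s : {perm G}) x : s x != x ->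
  is_K2 (porbit_graph s x) || is_cycle (porbit_graph s x).
Proof.
move=> sx; have [ssx|ssx] := eqVneq (s (s x)) x.
  have Vx : porbit s x = [set x; s x].
    apply/esym/eqP; rewrite eqEcard card_porbit_involutive // cards2 eq_sym sx.
    by rewrite subUset !sub1set porbit_id (mem_porbit s 1).
  apply/orP; left; apply/existsP; exists x; apply/existsP; exists (s x).
  rewrite eq_sym sx /verts /pedges /= Vx eqxx /= imsetU !imset_set1 ssx.
  by rewrite [[set s x; x]]setUC setUid.
apply/orP; right; apply/existsP.
have sz : size (traject s x #|porbit s x|) == #|verts (porbit_graph s x)|.
  by rewrite size_traject.
exists (Tuple sz); rewrite /= uniq_traject_porbit size_traject.
have memx : porbit s x =i traject s x #|porbit s x| by apply: porbit_traject.
(* The points [x], [s x] and [s (s x)] are distinct. *)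
have x3 : (2 < #|porbit s x|)%N.
  have sub : [set x; s x; s (s x)] \subset porbit s x.
    rewrite !subUset !sub1set porbit_id (mem_porbit s 1).
    by have := mem_porbit s 2 x; rewrite expgS permM.
  apply: leq_trans (subset_leq_card sub).
  by rewrite setUC cardsU1 cards2 !inE (inj_eq perm_inj) (negbTE sx)
             (negbTE ssx) eq_sym sx.
(* The trajectory closes up, so [next] on it agrees with [s]. *)
have cyc : fcycle s (traject s x #|porbit s x|).
  case def_n: #|porbit s x| x3 => [|m] // _ /=.
  rewrite rcons_path fpath_traject last_traject /=.
  by rewrite -iterS -def_n iter_porbit.
rewrite x3 /=; apply/andP; split; apply/eqP/setP => E.
  by rewrite inE memx.
apply/imsetP/imsetP => -[y yx ->]; exists y => //; first by rewrite -memx.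
- by rewrite (eqP (next_cycle cyc _)) // -memx.
- by rewrite memx.
- by rewrite (eqP (next_cycle cyc yx)).
Qed.

Lemma perm_factor (s : {perm G}) : (forall x, adj x (s x)) -> has_12_factor G.
Proof.
move=> sG; have sN x : s x != x.
  by apply: contraTneq (sG x) => ->; rewrite adj_irrefl.
exists ([set: G], [set [set y; s y] | y in [set: G]]); split=> //.
  apply/andP; split; last by apply/forall_inP => E _; apply: subsetT.
  by apply/subsetP => _ /imsetP[y _ ->]; rewrite mem_edges2.
apply/existsP; exists [set porbit_graph s x | x in [set: G]].
apply/and4P; split.
- by apply/forall_inP => _ /imsetP[x _ ->]; apply: porbit_graph_K2_cycle.
- apply/forall_inP => _ /imsetP[x _ ->].
  apply/forall_inP => _ /imsetP[y _ ->]; apply/implyP.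
  apply: contraR => /pred0Pn[z /andP[]] /=.
  rewrite /verts /= -!eq_porbit_mem => /eqP zx /eqP zy.
  by rewrite /porbit_graph -zx -zy.
- rewrite eq_sym -subTset; apply/subsetP => x _; apply/bigcupP.
  by exists (porbit_graph s x); [apply: imset_f | apply: porbit_id].
apply/eqP/setP => E; apply/imsetP/bigcupP => [[y _ ->]|[_ /imsetP[x _ ->]]].
  by exists (porbit_graph s y); apply: imset_f; rewrite ?porbit_id.
by case/imsetP => y _ ->; exists y.
Qed.

Lemma full_perrank_factor : full_perrank G <-> has_12_factor G.
Proof.
rewrite /full_perrank /perrank; split=> [perG|[H [sHG VH UH]]]; last first.
  apply/eqP; rewrite eqn_leq; apply/andP; split.
    by apply/bigmax_leqP => K _; apply: max_card.
  by rewrite -cardsT -VH; apply: leq_bigmax_cond; rewrite sHG.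
pose A := [pred H : pregraph G | is_subgraph H && K2_cycle_union H].
(* The empty subgraph is admissible, so the maximum defining the perrank is attained. *)
have A_gt0 : (0 < #|A|)%N.
  apply/card_gt0P; exists (set0, set0); rewrite inE /=; apply/andP; split.
    by rewrite /is_subgraph sub0set; apply/forall_inP => E; rewrite inE.
  apply/existsP; exists set0; rewrite !big_set0 !eqxx !andbT.
  by apply/andP; split; apply/forall_inP => C; rewrite inE.
have [H /andP[sHG UH]] := eq_bigmax_cond (fun H => #|verts H|) A_gt0.
move=> maxE; exists H; split=> //; apply/eqP.
by rewrite eqEcard subsetT cardsT -maxE -perG; apply: leqnn.
Qed.

Lemma det_perm (R : realFieldType) (sigma : {set G} -> int) :
    \det (signed_adjacency R sigma) != 0 ->
  exists s : {perm G}, forall x, adj x (s x).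
Proof.
move=> detN0; have /existsP[t /forallP tG] : [exists t : 'S_#|G|,
    [forall i, adj (enum_val i) (enum_val (t i))]].
  apply: contraNT detN0 => /existsPn noperm.
  rewrite /determinant big1 // => t _.
  have /forallPn[i /negbTE it] := noperm t.
  by rewrite (bigD1 i) //= mxE it mul0r mulr0.
have h_inj : injective (fun x : G => enum_val (t (enum_rank x))).
  by move=> x y /enum_val_inj/perm_inj/enum_rank_inj.
exists (perm h_inj) => x; rewrite permE.
by have := tG (enum_rank x); rewrite enum_rankK.
Qed.

Lemma perm_sign_det (R : realFieldType) (s : {perm G}) :
    (forall x, adj x (s x)) ->
  exists2 sigma : {set G} -> int,
    is_sign sigma & \det (signed_adjacency R sigma) != 0.
Proof.
move=> sG; pose e := [rel i j : 'I_#|G| | adj (enum_val i) (enum_val j)].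
have e_irr : irreflexive e by move=> i; apply: adj_irrefl.
have h_inj : injective (fun i : 'I_#|G| => enum_rank (s (enum_val i))).
  by move=> i j /enum_rank_inj/perm_inj/enum_val_inj.
have [|f detN0] := @exists_sign_det_neq0 R _ e e_irr (perm h_inj).
  by move=> i; rewrite /= permE enum_rankK.
(* Signs on sets of indices are pulled back to sets of vertices along [enum_rank]. *)
exists (fun E : {set G} => (-1) ^+ f [set enum_rank x | x in E]) => [E _|].
  by case: (f _); [left; rewrite expr1 | right; rewrite expr0].
rewrite (_ : signed_adjacency _ _ = sign_mx R e f) //.
apply/matrixP => i j; rewrite !mxE /=.
by rewrite imsetU !imset_set1 !enum_valK rmorphXn rmorphN1.
Qed.

End Factors.

Theorem theorem2p1 (R : realFieldType) (G : sgraph) :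
  ((exists sigma : {set G} -> int,
      is_sign sigma /\ \rank (signed_adjacency R sigma) = #|G|)
   <-> full_perrank G)
  /\ (full_perrank G <-> has_12_factor G).
Proof.
split; last exact: full_perrank_factor.
(* For a square matrix over a field, full rank, invertibility and nonzero determinant agree. *)
have rankE (A : 'M[R]_#|G|) : \rank A = #|G| <-> \det A != 0.
  rewrite -unitfE -[_ \is a _]/(A \in unitmx) -row_free_unit.
  by split=> [/eqP|/eqP].
split.
  case=> sigma [_ /rankE/det_perm[s sG]].
  exact/full_perrank_factor/(perm_factor sG).
case/full_perrank_factor/factor_perm => s /(perm_sign_det R)[sigma sign_sigma /rankE rk].
by exists sigma.
Qed.
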